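(* Let $\mathcal{J}(x,y)=\alpha x^2+\beta xy+\gamma y^2$ be an integral binary quadratic form with $\gcd(\alpha,\beta,\gamma)=1$ and $\beta^2-4\alpha\gamma\neq 0$. Let $F\in V_{\mathcal{J}}(\mathbb{Z})$ be irreducible with $Q_F$ maximal, and let $h,f,g$ be integral binary quadratic forms with $F=h(f,g)$ and $\mathcal{J}_{(f,g)}$ proportional to $\mathcal{J}$. Then $\Delta(h)$ is a fundamental discriminant, the pair $(f,g)$ is primitive, and $\Delta(\mathcal{J}_{(f,g)})=\pm 4$. In particular, $\Delta(\mathcal{J})\in\{1,4,-4\}$.
   Context: Twisted action: for $T=\begin{pmatrix}t_1&t_2\\t_3&t_4\end{pmatrix}\in\operatorname{GL}_2(\mathbb{R})$, $F_T(x,y)=\det(T)^{-2}F(t_1x+t_2y,t_3x+t_4y)$ for binary quartic forms. $M_{\mathcal{J}}=\begin{pmatrix}\beta&2\gamma\\-2\alpha&-\beta\end{pmatrix}$ and $V_{\mathcal{J}}(\mathbb{Z})$ is the set of integral binary quartic forms $F$ with $F_{M_{\mathcal{J}}}=F$. For a binary quadratic form $\varphi=\varphi_2x^2+\varphi_1xy+\varphi_0y^2$, $\Delta(\varphi)=\varphi_1^2-4\varphi_2\varphi_0$. The Jacobian determinant of $(f,g)$ is $\mathcal{J}_{(f,g)}(x,y)=(f_2g_1-f_1g_2)x^2+2(f_2g_0-f_0g_2)xy+(f_1g_0-f_0g_1)y^2$; an integral pair $(f,g)$ is primitive if $\Delta(\mathcal{J}_{(f,g)})\neq0$ and the gcd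 of the $x^2$-coefficient, half the $xy$-coefficient and the $y^2$-coefficient of $\mathcal{J}_{(f,g)}$ is $1$. $h(f,g)$ means $h(f(x,y),g(x,y))$. For an irreducible integral binary quartic form $F=a_4x^4+a_3x^3y+a_2x^2y^2+a_1xy^3+a_0y^4$ and a root $\theta$ of $F(x,1)$, $Q_F=\mathbb{Z}\oplus\mathbb{Z}a_4\theta\oplus\mathbb{Z}(a_4\theta^2+a_3\theta)\oplus\mathbb{Z}(a_4\theta^3+a_3\theta^2+a_2\theta)$, an order in $\mathbb{Q}(\theta)$; it is maximal if it equals the ring of integers of $\mathbb{Q}(\theta)$. *)

(* Defs.v *)
From HB Require Import structures.
From mathcomp Require Import all_boot all_order all_algebra all_field.
From mathcomp Require Export mpoly.

Set Implicit Arguments.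
Unset Strict Implicit.
Unset Printing Implicit Defensive.

Import Order.TTheory GRing.Theory Num.Theory.
Local Open Scope ring_scope.

(* qd_i is the coefficient of x^i y^(2-i), qt_i that of x^i y^(4-i), where
   x is 'X_0 and y is 'X_1. *)
Record quadratic (R : Type) := Quadratic { qd2 : R; qd1 : R; qd0 : R }.

Record quartic (R : Type) :=
  Quartic { qt4 : R; qt3 : R; qt2 : R; qt1 : R; qt0 : R }.

Definition quadratic_form (R : comNzRingType) (q : quadratic R) : {mpoly R[2]} :=
  qd2 q *: 'X_0 ^+ 2 + qd1 q *: ('X_0 * 'X_1) + qd0 q *: 'X_1 ^+ 2.

Definition quartic_form (R : comNzRingType) (F : quartic R) : {mpoly R[2]} :=
  qt4 F *: 'X_0 ^+ 4 + qt3 F *: ('X_0 ^+ 3 * 'X_1)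
  + qt2 F *: ('X_0 ^+ 2 * 'X_1 ^+ 2)
  + qt1 F *: ('X_0 * 'X_1 ^+ 3) + qt0 F *: 'X_1 ^+ 4.

Definition form_to_rat (P : {mpoly int[2]}) : {mpoly rat[2]} :=
  map_mpoly (intr : int -> rat) P.

Definition disc (R : comNzRingType) (q : quadratic R) : R :=
  qd1 q ^+ 2 - 4 * qd2 q * qd0 q.

(* h(f(x,y), g(x,y)) *)
Definition form_comp (R : comNzRingType) (h f g : quadratic R) : {mpoly R[2]} :=
  quadratic_form h \mPo [tuple quadratic_form f; quadratic_form g].

Definition primitive_quadratic (q : quadratic int) : Prop :=
  gcdz (gcdz (qd2 q) (qd1 q)) (qd0 q) = 1.

(* Defined for quartic forms over any field, and meaningful for invertible T
   only. *)
Definition twisted_action (K : fieldType) (T : 'M[K]_2) (P : {mpoly K[2]}) :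
    {mpoly K[2]} :=
  (\det T) ^- 2 *: (P \mPo [tuple \sum_(j < 2) T i j *: 'X_j | i < 2]).

Definition mxJ (R : comNzRingType) (J : quadratic R) : 'M[R]_2 :=
  \matrix_(i < 2, j < 2)
    if i == 0 then (if j == 0 then qd1 J else 2 * qd0 J)
    else (if j == 0 then - (2 * qd2 J) else - qd1 J).

(* As J and F are integral, the identity of real forms defining V_J(Z) is an
   identity of rational ones. *)
Definition in_VJ (J : quadratic int) (F : quartic int) : Prop :=
  twisted_action (map_mx (intr : int -> rat) (mxJ J))
    (form_to_rat (quartic_form F)) = form_to_rat (quartic_form F).

Definition jacobian (R : comNzRingType) (f g : quadratic R) : quadratic R :=
  Quadratic (qd2 f * qd1 g - qd1 f * qd2 g)
            (2 * (qd2 f * qd0 g - qd0 f * qd2 g))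
            (qd1 f * qd0 g - qd0 f * qd1 g).

Definition proportional (p q : quadratic int) : Prop :=
  exists c : rat, form_to_rat (quadratic_form p) = c *: form_to_rat (quadratic_form q).

(* The division by 2 is exact. *)
Definition primitive_pair (f g : quadratic int) : Prop :=
  let J := jacobian f g in
  disc J != 0 /\ gcdz (gcdz (qd2 J) (qd1 J %/ 2)%Z) (qd0 J) = 1.

Definition irreducible_elt (R : idomainType) (x : R) : Prop :=
  [/\ x != 0, x \isn't a GRing.unit &
      forall y z : R, x = y * z -> y \is a GRing.unit \/ z \is a GRing.unit].

(* Irreducibility over the rationals: the content plays no role. *)
Definition irreducible_quartic (F : quartic int) : Prop :=
  irreducible_elt (form_to_rat (quartic_form F)).

(* F(x,1); Poly lists the coefficients from the constant one up. *)
Definition dehomogenize (R : comNzRingType) (F : quartic R) : {poly R} :=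
  Poly [:: qt0 F; qt1 F; qt2 F; qt3 F; qt4 F].

Definition is_root_of (F : quartic int) (theta : algC) : Prop :=
  root (map_poly (intr : int -> algC) (dehomogenize F)) theta.

Definition QF_basis (F : quartic int) (theta : algC) : 4.-tuple algC :=
  let a4 := (qt4 F)%:~R in let a3 := (qt3 F)%:~R in let a2 := (qt2 F)%:~R in
  [tuple 1; a4 * theta; a4 * theta ^+ 2 + a3 * theta;
            a4 * theta ^+ 3 + a3 * theta ^+ 2 + a2 * theta].

Definition in_QF (F : quartic int) (theta z : algC) : Prop :=
  inIntSpan (QF_basis F theta) z.

(* z lies in the field generated over the rationals by theta. *)
Definition in_Qadjoin (theta z : algC) : Prop :=
  exists p q : {poly rat},
    (map_poly ratr q).[theta] != 0 /\
    z = (map_poly ratr p).[theta] / (map_poly ratr q).[theta].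

(* Aint is the predicate of algebraic integers. *)
Definition QF_maximal (F : quartic int) (theta : algC) : Prop :=
  forall z : algC, in_QF F theta z <-> (in_Qadjoin theta z /\ z \in Aint).

Definition squarefree (m : int) : Prop :=
  forall d : int, (d ^+ 2 %| m)%Z -> `|d| = 1.

(* The discriminants of quadratic number fields; in particular 1 is excluded. *)
Definition fundamental_discriminant (D : int) : Prop :=
  D <> 1 /\
  (((D %% 4)%Z = 1 /\ squarefree D) \/
   (exists m : int, [/\ D = 4 * m, (m %% 4)%Z = 2 \/ (m %% 4)%Z = 3
                      & squarefree m])).

(* Main.v *)
(* The element eta = h2 f(theta)/g(theta) is a root of X^2 + h1 X + h0 h2, so it is
   an algebraic integer of discriminant D = disc h in Q(theta), and Q_F contains it.
   Let r be the resultant of f and g, so that the Jacobian has discriminant 4r.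
   In the basis of Q_F, the coordinates of r eta off 1 are, up to sign, the 2x2
   minors of (f, g), so r divides every minor; as r is a quadratic form in the
   minors, r is a unit and the minors are coprime. If D = d^2 (b^2 - 4c), then Q_F
   also contains the algebraic integer (b + (2 eta + h1)/d)/2, and comparing
   coordinates again, d divides every minor, so d is a unit too. *)
Require Import Defs.
From mathcomp Require Import all_boot all_order all_algebra all_field.
From mathcomp Require Import zify ring lra.

Set Implicit Arguments.
Unset Strict Implicit.
Unset Printing Implicit Defensive.

Import Order.TTheory GRing.Theory Num.Theory.
Local Open Scope ring_scope.

(** * Integers *)

Lemma int_even_or_odd (n : int) : exists k : int, n = 2 * k \/ n = 2 * k + 1.
Proof. by exists (n %/ 2)%Z; lia. Qed.

Lemma modz4_sqr_sub (b c : int) :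
  ((b ^+ 2 - 4 * c) %% 4)%Z = 0 \/ ((b ^+ 2 - 4 * c) %% 4)%Z = 1.
Proof.
have [k [->|->]] := int_even_or_odd b; [left | right].
- have -> : (2 * k) ^+ 2 - 4 * c = 4 * (k ^+ 2 - c) by ring.
  by move: (_ - _) => n; lia.
- have -> : (2 * k + 1) ^+ 2 - 4 * c = 4 * (k ^+ 2 + k - c) + 1 by ring.
  by move: (_ - _) => n; lia.
Qed.

(** Every integer that is 0 or 1 modulo 4 has the form [b ^+ 2 - 4 * c] with [b] equal to 0 or 1, so
    [D] can fail to be fundamental only through a square factor whose cofactor is again a
    discriminant. *)
Lemma fundamental_discriminant_minimal (D : int) :
  ((D %% 4)%Z = 0 \/ (D %% 4)%Z = 1) -> D <> 1 ->
  (forall d b c : int, D = d ^+ 2 * (b ^+ 2 - 4 * c) -> `|d| = 1) ->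
  fundamental_discriminant D.
Proof.
move=> Dm4 D1 Dmin; split=> //.
case: Dm4 => Dm4; [right | left].
- exists (D %/ 4)%Z; set m := (D %/ 4)%Z.
  have Dm : D = 4 * m by rewrite /m; lia.
  split=> //; last first.
    by move=> d /dvdzP[q mq]; apply: (Dmin d 0 (- q)); rewrite Dm mq; ring.
  (* If [m] were 0 or 1 modulo 4, then [D = 2 ^+ 2 * m] would contradict minimality at [d = 2]. *)
  have m01 b : (m %% 4)%Z = b ^+ 2 -> False.
    move=> mb; have := Dmin 2 b (- (m %/ 4)%Z); rewrite -mb => D2.
    by have : `|2%:Z| = 1 by apply: D2; rewrite Dm; lia.
  by have := m01 0; have := m01 1; lia.
- split=> // d /dvdzP[q Dq]; apply: (Dmin d 1 (- (q %/ 4)%Z)).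
  suff qm : (q %% 4)%Z = 1 by rewrite Dq mulrC; congr (_ * _); lia.
  have [k [dE|dE]] := int_even_or_odd d.
  + have DE : D = 4 * (q * k ^+ 2) by rewrite Dq dE; ring.
    by move: (_ * _ ^+ _) DE => n; lia.
  + have DE : D = 4 * (q * (k ^+ 2 + k)) + q by rewrite Dq dE; ring.
    by move: (q * (_ + _)) DE => n; lia.
Qed.

Lemma norm_int_mul_eq1 (m n : int) : m * n = 1 -> `|m| = 1.
Proof.
move=> mn; have : (m %| 1)%Z by apply/dvdzP; exists n; rewrite mulrC.
by rewrite dvdz1 -abszE => /eqP ->.
Qed.

Lemma normr1_cases (n : int) : `|n| = 1 -> n = 1 \/ n = -1.
Proof. lia. Qed.

Lemma cancel2 (m d r n : int) : 2 * m = 2 * d * r * n -> m = d * r * n.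
Proof. by rewrite -!mulrA => /mulfI; apply. Qed.

(** * Coefficients of forms *)

Lemma meval_expr (n k : nat) (R : comNzRingType) (v : 'I_n -> R)
    (p : {mpoly R[n]}) :
  (p ^+ k).@[v] = p.@[v] ^+ k.
Proof. by elim: k => [|k IHk]; rewrite ?meval1 // !exprS mevalM IHk. Qed.

Lemma meval_quadratic_form (R : comNzRingType) (q : quadratic R) (v : 'I_2 -> R) :
  (quadratic_form q).@[v] =
  qd2 q * v 0 ^+ 2 + qd1 q * (v 0 * v 1) + qd0 q * v 1 ^+ 2.
Proof.
rewrite /quadratic_form !mevalD.
congr (_ + _ + _); rewrite mevalZ; congr (_ * _).
- by rewrite meval_expr mevalXU.
- by rewrite mevalM !mevalXU.
- by rewrite meval_expr mevalXU.
Qed.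

Lemma meval_quartic_form (R : comNzRingType) (F : quartic R) (v : 'I_2 -> R) :
  (quartic_form F).@[v] =
  qt4 F * v 0 ^+ 4 + qt3 F * (v 0 ^+ 3 * v 1) + qt2 F * (v 0 ^+ 2 * v 1 ^+ 2)
  + qt1 F * (v 0 * v 1 ^+ 3) + qt0 F * v 1 ^+ 4.
Proof.
rewrite /quartic_form !mevalD.
congr (_ + _ + _ + _ + _); rewrite mevalZ; congr (_ * _).
- by rewrite meval_expr mevalXU.
- by rewrite mevalM meval_expr !mevalXU.
- by rewrite mevalM !meval_expr !mevalXU.
- by rewrite mevalM meval_expr !mevalXU.
- by rewrite meval_expr mevalXU.
Qed.

Lemma map_quartic_form (R S : comNzRingType) (f : {rmorphism R -> S}) (F : quartic R) :
  map_mpoly f (quartic_form F) =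
  quartic_form (Quartic (f (qt4 F)) (f (qt3 F)) (f (qt2 F)) (f (qt1 F)) (f (qt0 F))).
Proof.
rewrite /quartic_form !rmorphD /=; congr (_ + _ + _ + _ + _);
  rewrite map_mpolyZ; congr (_ *: _).
- by rewrite rmorphXn /= map_mpolyX.
- by rewrite rmorphM rmorphXn /= !map_mpolyX.
- by rewrite rmorphM !rmorphXn /= !map_mpolyX.
- by rewrite rmorphM rmorphXn /= !map_mpolyX.
- by rewrite rmorphXn /= map_mpolyX.
Qed.

Lemma map_quadratic_form (R S : comNzRingType) (f : {rmorphism R -> S}) (q : quadratic R) :
  map_mpoly f (quadratic_form q) =
  quadratic_form (Quadratic (f (qd2 q)) (f (qd1 q)) (f (qd0 q))).
Proof.
rewrite /quadratic_form !rmorphD /=; congr (_ + _ + _);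
  rewrite map_mpolyZ; congr (_ *: _).
- by rewrite rmorphXn /= map_mpolyX.
- by rewrite rmorphM /= !map_mpolyX.
- by rewrite rmorphXn /= map_mpolyX.
Qed.

(** Values at five pairwise non-proportional points determine a binary quartic form, so a linear
    system replaces the expansion of the composition. *)
Lemma quartic_form_comp_coefs (F : quartic int) (h f g : quadratic int) :
  quartic_form F = form_comp h f g ->
  [/\ qt4 F = qd2 h * qd2 f ^+ 2 + qd1 h * (qd2 f * qd2 g) + qd0 h * qd2 g ^+ 2,
      qt3 F = 2 * qd2 h * qd2 f * qd1 f + qd1 h * (qd2 f * qd1 g + qd1 f * qd2 g)
              + 2 * qd0 h * qd2 g * qd1 g,
      qt2 F = qd2 h * (2 * qd2 f * qd0 f + qd1 f ^+ 2)
              + qd1 h * (qd2 f * qd0 g + qd1 f * qd1 g + qd0 f * qd2 g)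
              + qd0 h * (2 * qd2 g * qd0 g + qd1 g ^+ 2),
      qt1 F = 2 * qd2 h * qd1 f * qd0 f + qd1 h * (qd1 f * qd0 g + qd0 f * qd1 g)
              + 2 * qd0 h * qd1 g * qd0 g
    & qt0 F = qd2 h * qd0 f ^+ 2 + qd1 h * (qd0 f * qd0 g) + qd0 h * qd0 g ^+ 2].
Proof.
move=> E.
have ev (x y : int) := congr1 (meval (fun i => if i == 0 then x else y)) E.
have e10 := ev 1 0; have e01 := ev 0 1; have e11 := ev 1 1.
have e1m := ev 1 (-1); have e21 := ev 2 1.
move: e10 e01 e11 e1m e21.
rewrite /form_comp !comp_mpoly_meval !meval_quadratic_form !meval_quartic_form /=.
case: F h f g {E ev} => a4 a3 a2 a1 a0 [h2 h1 h0] [f2 f1 f0] [g2 g1 g0] /=.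
move=> e10 e01 e11 e1m e21; split; lra.
Qed.

Lemma proportional_coefs (p q : quadratic int) :
  proportional p q ->
  exists c : rat, [/\ (qd2 p)%:~R = c * (qd2 q)%:~R,
    (qd1 p)%:~R = c * (qd1 q)%:~R & (qd0 p)%:~R = c * (qd0 q)%:~R].
Proof.
move=> [c E]; exists c.
have ev (x y : rat) := congr1 (meval (fun i => if i == 0 then x else y)) E.
have := ev 1 0; have := ev 0 1; have := ev 1 1.
rewrite /form_to_rat !map_quadratic_form !mevalZ !meval_quadratic_form /=.
by move=> e11 e01 e10; split; lra.
Qed.

Lemma mpoly_meval0_not_unit (n : nat) (K : fieldType) (p : {mpoly K[n]}) :
  p.@[fun=> 0] = 0 -> p \isn't a GRing.unit.
Proof.
by move=> p0; apply/negP => /(rmorph_unit (meval (fun=> 0))); rewrite /= p0 unitr0.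
Qed.

Lemma irreducible_quartic_factor (F : quartic int) (p q : {mpoly rat[2]}) :
  irreducible_quartic F -> p.@[fun=> 0] = 0 -> q.@[fun=> 0] = 0 ->
  form_to_rat (quartic_form F) <> p * q.
Proof.
move=> [_ _ irrF] /mpoly_meval0_not_unit pU /mpoly_meval0_not_unit qU FE.
by have [] := irrF _ _ FE; apply/negP.
Qed.

(** * Linear independence of the powers of theta *)

(** Faithful only in degree at most [n]: higher coefficients are dropped, hence the size bounds in
    [homogenizeM]. *)
Definition homogenize (R : comNzRingType) (n : nat) (p : {poly R}) : {mpoly R[2]} :=
  \sum_(i < n.+1) p`_i *: ('X_0 ^+ i * 'X_1 ^+ (n - i)).

Lemma homogenizeD (R : comNzRingType) (n : nat) (p q : {poly R}) :
  homogenize n (p + q) = homogenize n p + homogenize n q.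
Proof.
by rewrite /homogenize -big_split /=; apply: eq_bigr => i _; rewrite coefD scalerDl.
Qed.

Lemma homogenizeZ (R : comNzRingType) (n : nat) (c : R) (p : {poly R}) :
  homogenize n (c *: p) = c *: homogenize n p.
Proof.
by rewrite /homogenize scaler_sumr; apply: eq_bigr => i _; rewrite coefZ scalerA.
Qed.

Lemma homogenize_sum (R : comNzRingType) (n : nat) (I : Type) (r : seq I) (p : I -> {poly R}) :
  homogenize n (\sum_(i <- r) p i) = \sum_(i <- r) homogenize n (p i).
Proof.
apply: (big_morph _ (homogenizeD n)).
by rewrite /homogenize big1 // => i _; rewrite coef0 scale0r.
Qed.

Lemma homogenizeXn (R : comNzRingType) (n k : nat) :
  (k <= n)%N -> homogenize n 'X^k = 'X_0 ^+ k * 'X_1 ^+ (n - k) :> {mpoly R[2]}.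
Proof.
move=> kn; rewrite /homogenize (bigD1 (inord k)) //= big1 => [|i ik].
  by rewrite inordK // coefXn eqxx scale1r addr0.
rewrite coefXn; case: eqP => [ki|_]; last by rewrite scale0r.
by move: ik; rewrite -ki inord_val eqxx.
Qed.

Lemma homogenizeM (R : comNzRingType) (m n : nat) (p q : {poly R}) :
  (size p <= m.+1)%N -> (size q <= n.+1)%N ->
  homogenize (m + n) (p * q) = homogenize m p * homogenize n q.
Proof.
have polyE k (r : {poly R}) : (size r <= k)%N -> r = \sum_(i < k) r`_i *: 'X^i.
  move=> rk; rewrite -poly_def; apply/polyP => i; rewrite coef_poly.
  by case: ltnP => // ki; rewrite nth_default // (leq_trans rk).
move=> /polyE pE /polyE qE; rewrite {1}pE {1}qE big_distrlr /= homogenize_sum.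
rewrite /homogenize big_distrlr /=; apply: eq_bigr => i _.
rewrite -/(homogenize _ _) homogenize_sum; apply: eq_bigr => j _.
rewrite -scalerAl -scalerAr -exprD !homogenizeZ homogenizeXn; last first.
  by rewrite leq_add // -ltnS.
rewrite -!scalerAl -!scalerAr; congr (_ *: (_ *: _)).
have -> : (m + n - (i + j) = (m - i) + (n - j))%N.
  by have := ltn_ord i; have := ltn_ord j; lia.
by rewrite !exprD mulrACA.
Qed.

Lemma meval0_homogenize (K : fieldType) (n : nat) (p : {poly K}) :
  (0 < n)%N -> (homogenize n p).@[fun=> 0] = 0.
Proof.
move=> n0; rewrite /homogenize raddf_sum big1 //= => i _.
rewrite mevalZ mevalM !meval_expr !mevalXU -exprD subnKC -1?ltnS //.
by rewrite expr0n gtn_eqF // mulr0.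
Qed.

Lemma quartic_form_homogenize (F : quartic int) :
  form_to_rat (quartic_form F) = homogenize 4 (map_poly intr (dehomogenize F)).
Proof.
rewrite /form_to_rat map_quartic_form /homogenize /dehomogenize.
rewrite map_Poly_id0 ?rmorph0 // !big_ord_recr big_ord0 /= !coef_cons /=.
rewrite add0r expr0 mul1r subnn mulr1 [RHS](ACl (5*4*3*2*1)) /quartic_form /=.
by [].
Qed.

Lemma map_dehomogenize (R : nzRingType) (F : quartic int) :
  map_poly (intr : int -> R) (dehomogenize F) =
  Poly [:: (qt0 F)%:~R; (qt1 F)%:~R; (qt2 F)%:~R; (qt3 F)%:~R; (qt4 F)%:~R].
Proof. by rewrite /dehomogenize map_Poly_id0 // rmorph0. Qed.

(** Otherwise the variable ['X_1], which is [homogenize 1 1], would split off. *)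
Lemma irreducible_quartic_lead (F : quartic int) :
  irreducible_quartic F -> qt4 F != 0.
Proof.
move=> irrF; apply/eqP => a40.
apply: (irreducible_quartic_factor irrF (meval0_homogenize (n := 1) 1 isT)
  (meval0_homogenize (n := 3) (map_poly intr (dehomogenize F)) isT)).
rewrite quartic_form_homogenize -homogenizeM ?mul1r ?size_poly1 //.
rewrite map_dehomogenize a40; apply/leq_sizeP.
by move=> [|[|[|[|[|k]]]]] // _; rewrite coef_Poly //= nth_nil.
Qed.

Lemma size_dehomogenize (R : numDomainType) (F : quartic int) :
  qt4 F != 0 -> size (map_poly (intr : int -> R) (dehomogenize F)) = 5%N.
Proof. by move=> a4; rewrite map_dehomogenize (@PolyK _ 0) //= intr_eq0. Qed.

(** Homogenizing both factors in their exact degrees factors the form itself; these degrees add up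
    to 4 because [qt4 F] is nonzero. *)
Lemma irreducible_quartic_no_factor (F : quartic int) (q r : {poly rat}) :
  irreducible_quartic F -> (1 < size q)%N -> (1 < size r)%N ->
  map_poly intr (dehomogenize F) <> q * r.
Proof.
move=> irrF q1 r1 E; have q0 : (0 < (size q).-1)%N by rewrite -ltnS prednK // ltnW.
have r0 : (0 < (size r).-1)%N by rewrite -ltnS prednK // ltnW.
apply: (irreducible_quartic_factor irrF (meval0_homogenize q q0)
  (meval0_homogenize r r0)).
rewrite quartic_form_homogenize -homogenizeM ?leqSpred // -E; congr homogenize.
have := size_dehomogenize rat (irreducible_quartic_lead irrF).
have nz (s : {poly rat}) : (1 < size s)%N -> s != 0.
  by rewrite -size_poly_gt0 => /ltnW.
rewrite E (size_mul (nz _ q1) (nz _ r1)).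
by move: q1 r1 => /=; move: (size q) (size r) => m n; lia.
Qed.

(** In other words, [theta] has degree 4 over the rationals: for nonzero [p], the gcd of [p] and
    F(x,1) would be a proper factor with root [theta]. *)
Lemma irreducible_quartic_minimal (F : quartic int) (theta : algC) (p : {poly rat}) :
  irreducible_quartic F -> is_root_of F theta -> (size p <= 4)%N ->
  root (map_poly ratr p) theta -> p = 0.
Proof.
move=> irrF Ftheta p4 ptheta; apply/eqP; apply: contraT => p0.
pose P : {poly rat} := map_poly intr (dehomogenize F).
have Psz : size P = 5%N by apply: size_dehomogenize; apply: irreducible_quartic_lead.
have P0 : P != 0 by rewrite -size_poly_gt0 Psz.
have Ptheta : root (map_poly ratr P) theta.
  rewrite /P -map_poly_comp (eq_map_poly (g := intr)) // => x /=.
  by rewrite ratr_int.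
pose d := gcdp p P.
have d0 : d != 0 by rewrite gcdp_eq0 negb_and p0.
have droot : root (map_poly ratr d) theta.
  by rewrite gcdp_map root_gcd ptheta.
have d1 : (1 < size d)%N.
  rewrite -(size_map_poly (ratr : rat -> algC)).
  by apply: (root_size_gt1 _ droot); rewrite map_poly_eq0.
have d4 : (size d <= 4)%N.
  by apply: leq_trans p4; apply: dvdp_leq (dvdp_gcdl _ _).
have /dvdpP[r Pr] : d %| P by apply: dvdp_gcdr.
have r0 : r != 0 by apply: contraNneq P0 => r0; rewrite Pr r0 mul0r.
have r1 : (1 < size r)%N.
  by move: Psz d4; rewrite Pr (size_mul r0 d0); move: (size r) (size d) => m n; lia.
by have := irreducible_quartic_no_factor irrF r1 d1 Pr.
Qed.

Lemma theta_powers_free (F : quartic int) (theta : algC) (c0 c1 c2 c3 : int) :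
  irreducible_quartic F -> is_root_of F theta ->
  c0%:~R + c1%:~R * theta + c2%:~R * theta ^+ 2 + c3%:~R * theta ^+ 3 = 0 ->
  [/\ c0 = 0, c1 = 0, c2 = 0 & c3 = 0].
Proof.
move=> irrF Ftheta rel.
pose p : {poly rat} := Poly [:: c0%:~R; c1%:~R; c2%:~R; c3%:~R].
have p0 : p = 0.
  apply: (irreducible_quartic_minimal irrF Ftheta); first exact: size_Poly.
  rewrite /root map_Poly_id0 ?rmorph0 // horner_Poly /= !ratr_int.
  by apply/eqP; rewrite -[RHS]rel; ring.
have cE i : [:: c0%:~R; c1%:~R; c2%:~R; c3%:~R]`_i = 0 :> rat.
  by rewrite -coef_Poly -/p p0 coef0.
by split; apply/eqP; rewrite -(intr_eq0 rat); apply/eqP;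
  [exact: (cE 0%N) | exact: (cE 1%N) | exact: (cE 2%N) | exact: (cE 3%N)].
Qed.

(* With 1, the entries of QF_basis. *)
Definition zeta1 (F : quartic int) (theta : algC) : algC := (qt4 F)%:~R * theta.
Definition zeta2 (F : quartic int) (theta : algC) : algC :=
  (qt4 F)%:~R * theta ^+ 2 + (qt3 F)%:~R * theta.
Definition zeta3 (F : quartic int) (theta : algC) : algC :=
  (qt4 F)%:~R * theta ^+ 3 + (qt3 F)%:~R * theta ^+ 2 + (qt2 F)%:~R * theta.

Lemma in_QF_coords (F : quartic int) (theta z : algC) :
  in_QF F theta z -> exists k0 k1 k2 k3 : int,
    z = k0%:~R + k1%:~R * zeta1 F theta + k2%:~R * zeta2 F theta
        + k3%:~R * zeta3 F theta.
Proof.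
move=> [k ->]; exists (k ord0), (k (inord 1)), (k (inord 2)), (k (inord 3)).
rewrite (eq_bigr (fun i : 'I_4 => (k (inord i))%:~R * (QF_basis F theta)`_i)).
  rewrite !big_ord_recr big_ord0 /= add0r mulr1.
  by rewrite (_ : inord 0 = ord0) //; apply/val_inj; rewrite /= inordK.
by move=> i _; rewrite inord_val mulrzl.
Qed.

(** The passage to powers of [theta] is triangular, with the nonzero [qt4 F] on the diagonal off the
    entry 1. *)
Lemma zeta_free (F : quartic int) (theta : algC) (k0 k1 k2 k3 : int) :
  irreducible_quartic F -> is_root_of F theta ->
  k0%:~R + k1%:~R * zeta1 F theta + k2%:~R * zeta2 F theta
    + k3%:~R * zeta3 F theta = 0 ->
  [/\ k1 = 0, k2 = 0 & k3 = 0].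
Proof.
rewrite /zeta1 /zeta2 /zeta3 => irrF Ftheta rel; have a4 := irreducible_quartic_lead irrF.
have [|_ c1 c2 c3] := theta_powers_free (c0 := k0)
  (c1 := k1 * qt4 F + k2 * qt3 F + k3 * qt2 F) (c2 := k2 * qt4 F + k3 * qt3 F)
  (c3 := k3 * qt4 F) irrF Ftheta.
  by rewrite -[RHS]rel; ring.
have k30 : k3 = 0 by apply/eqP; move/eqP: c3; rewrite mulf_eq0 (negPf a4) orbF.
have k20 : k2 = 0.
  by apply/eqP; move/eqP: c2; rewrite k30 mul0r addr0 mulf_eq0 (negPf a4) orbF.
split=> //; apply/eqP; move/eqP: c1.
by rewrite k20 k30 !mul0r !addr0 mulf_eq0 (negPf a4) orbF.
Qed.

(** * The integer eta and the minors of (f, g) *)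

Lemma is_root_ofE (F : quartic int) (theta : algC) :
  is_root_of F theta ->
  (qt4 F)%:~R * theta ^+ 4 + (qt3 F)%:~R * theta ^+ 3 + (qt2 F)%:~R * theta ^+ 2
  + (qt1 F)%:~R * theta + (qt0 F)%:~R = 0.
Proof.
rewrite /is_root_of /root map_dehomogenize horner_Poly /= => /eqP E.
by rewrite -[RHS]E; ring.
Qed.

Definition quadratic_at (q : quadratic int) (x : algC) : algC :=
  (qd2 q)%:~R * x ^+ 2 + (qd1 q)%:~R * x + (qd0 q)%:~R.

Lemma form_comp_at_root (F : quartic int) (theta : algC) (h f g : quadratic int) :
  quartic_form F = form_comp h f g -> is_root_of F theta ->
  (qd2 h)%:~R * quadratic_at f theta ^+ 2
  + (qd1 h)%:~R * (quadratic_at f theta * quadratic_at g theta)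
  + (qd0 h)%:~R * quadratic_at g theta ^+ 2 = 0.
Proof.
move=> /quartic_form_comp_coefs[a4 a3 a2 a1 a0] /is_root_ofE Ftheta.
by rewrite -[RHS]Ftheta a4 a3 a2 a1 a0 /quadratic_at; ring.
Qed.

(* If tau = f(x)/g(x) is a root of h and A = f - tau * g, then F is h2 times the
   product of A and its conjugate, so at a root x of A the elements of the basis
   of Q_F are affine functions of x whose slopes are proportional to the
   conjugate coefficients of A. The vector (M1, M2, M3) is orthogonal to the
   coefficient vectors of f and g, hence the combination below is affine in
   h2 * tau alone. *)
Lemma theta_power_identity (R : comNzRingType)
    (h2 h1 h0 f2 f1 f0 g2 g1 g0 a4 a3 a2 a1 a0 x : R) :
  let M1 := f1 * g0 - f0 * g1 in
  let M2 := f0 * g2 - f2 * g0 in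
  let M3 := f2 * g1 - f1 * g2 in
  let P := M2 * f2 + M3 * f1 in
  let Q := M2 * g2 + M3 * g1 in
  a4 = h2 * f2 ^+ 2 + h1 * (f2 * g2) + h0 * g2 ^+ 2 ->
  a3 = 2 * h2 * f2 * f1 + h1 * (f2 * g1 + f1 * g2) + 2 * h0 * g2 * g1 ->
  a2 = h2 * (2 * f2 * f0 + f1 ^+ 2) + h1 * (f2 * g0 + f1 * g1 + f0 * g2)
       + h0 * (2 * g2 * g0 + g1 ^+ 2) ->
  a1 = 2 * h2 * f1 * f0 + h1 * (f1 * g0 + f0 * g1) + 2 * h0 * g1 * g0 ->
  a0 = h2 * f0 ^+ 2 + h1 * (f0 * g0) + h0 * g0 ^+ 2 ->
  (M2 ^+ 2 - M3 * M1) * (h2 * (f2 * x ^+ 2 + f1 * x + f0)) =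
  - (g2 * x ^+ 2 + g1 * x + g0)
    * (M1 * (a4 * x) + M2 * (a4 * x ^+ 2 + a3 * x)
       + M3 * (a4 * x ^+ 3 + a3 * x ^+ 2 + a2 * x)
       + (h2 * f0 * P + h1 * f0 * Q + h0 * g0 * Q))
  + (g2 * M3 * x + Q)
    * (a4 * x ^+ 4 + a3 * x ^+ 3 + a2 * x ^+ 2 + a1 * x + a0).
Proof. by move=> M1 M2 M3 P Q -> -> -> -> ->; rewrite /Q /P /M1 /M2 /M3; ring. Qed.

(** Signs and order are those of the cross product of [(f2, f1, f0)] and [(g2, g1, g0)]. *)
Definition minor1 (f g : quadratic int) : int := qd1 f * qd0 g - qd0 f * qd1 g.
Definition minor2 (f g : quadratic int) : int := qd0 f * qd2 g - qd2 f * qd0 g.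
Definition minor3 (f g : quadratic int) : int := qd2 f * qd1 g - qd1 f * qd2 g.
Definition resultant2 (f g : quadratic int) : int :=
  minor2 f g ^+ 2 - minor3 f g * minor1 f g.

Lemma disc_jacobian (f g : quadratic int) :
  disc (jacobian f g) = 4 * resultant2 f g.
Proof. by rewrite /disc /= /resultant2 /minor1 /minor2 /minor3; ring. Qed.

(** By independence of 1, [theta] and its square, a zero value would make [g] vanish identically,
    and the minors with it. *)
Lemma quadratic_at_neq0 (F : quartic int) (theta : algC) (f g : quadratic int) :
  irreducible_quartic F -> is_root_of F theta -> resultant2 f g != 0 ->
  quadratic_at g theta != 0.
Proof.
move=> irrF Ftheta; apply: contraNneq => g0.
have [|g00 g10 g20 _] := theta_powers_free (c0 := qd0 g) (c1 := qd1 g)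
  (c2 := qd2 g) (c3 := 0) irrF Ftheta.
  by rewrite -[RHS]g0 /quadratic_at; ring.
by rewrite /resultant2 /minor1 /minor2 /minor3 g00 g10 g20; apply/eqP; ring.
Qed.

Definition eta (h f g : quadratic int) (theta : algC) : algC :=
  (qd2 h)%:~R * quadratic_at f theta / quadratic_at g theta.

Lemma eta_root (F : quartic int) (theta : algC) (h f g : quadratic int) :
  quartic_form F = form_comp h f g -> is_root_of F theta ->
  quadratic_at g theta != 0 ->
  eta h f g theta ^+ 2 + (qd1 h)%:~R * eta h f g theta
    + (qd0 h * qd2 h)%:~R = 0.
Proof.
move=> FE Ftheta g0.
(* Scaled by [h2 / g(theta)^2], the relation [h(f(theta), g(theta)) = 0] becomes monic in [eta]. *)
have -> : 0 = (qd2 h)%:~R * 0 / quadratic_at g theta ^+ 2 by rewrite mulr0 mul0r.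
by rewrite -(form_comp_at_root FE Ftheta) /eta; field.
Qed.

(** This is [theta_power_identity] at [theta], where the multiple of F(x,1) vanishes, divided by
    [g(theta)]; [n] is the constant bracket there. *)
Lemma eta_coords (F : quartic int) (theta : algC) (h f g : quadratic int) :
  quartic_form F = form_comp h f g -> is_root_of F theta ->
  quadratic_at g theta != 0 ->
  exists n : int,
  (resultant2 f g)%:~R * eta h f g theta =
  - ((minor1 f g)%:~R * zeta1 F theta
     + (minor2 f g)%:~R * zeta2 F theta
     + (minor3 f g)%:~R * zeta3 F theta + n%:~R).
Proof.
move=> /quartic_form_comp_coefs[a4 a3 a2 a1 a0] /is_root_ofE Ftheta g0.
pose P := minor2 f g * qd2 f + minor3 f g * qd1 f.
pose Q := minor2 f g * qd2 g + minor3 f g * qd1 g.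
exists (qd2 h * qd0 f * P + qd1 h * qd0 f * Q + qd0 h * qd0 g * Q).
apply: (mulIf g0); have -> : (resultant2 f g)%:~R * eta h f g theta * quadratic_at g theta
    = (resultant2 f g)%:~R * ((qd2 h)%:~R * quadratic_at f theta).
  by rewrite /eta; field.
have /= E := @theta_power_identity algC (qd2 h)%:~R (qd1 h)%:~R (qd0 h)%:~R
  (qd2 f)%:~R (qd1 f)%:~R (qd0 f)%:~R (qd2 g)%:~R (qd1 g)%:~R (qd0 g)%:~R
  (qt4 F)%:~R (qt3 F)%:~R (qt2 F)%:~R (qt1 F)%:~R (qt0 F)%:~R theta.
rewrite Ftheta mulr0 addr0 /= in E.
rewrite /resultant2 /P /Q /minor1 /minor2 /minor3 /quadratic_at /zeta1 /zeta2 /zeta3.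
have [:e4 e3 e2 e1 e0] E' := E (e4 : _) (e3 : _) (e2 : _) (e1 : _) (e0 : _).
- by rewrite a4; ring.
- by rewrite a3; ring.
- by rewrite a2; ring.
- by rewrite a1; ring.
- by rewrite a0; ring.
by apply: etrans (etrans E' _); ring.
Qed.

(** * Consequences of the maximality of Q_F *)

Lemma Aint_quadratic (b c : int) (x : algC) :
  x ^+ 2 + b%:~R * x + c%:~R = 0 -> x \in Aint.
Proof.
move=> xE; pose p : {poly algC} := Poly [:: c%:~R; b%:~R; 1].
have ps : p = [:: c%:~R; b%:~R; 1] :> seq algC by rewrite (@PolyK _ 0) //= oner_eq0.
apply: (@root_monic_Aint p).
- by rewrite /root horner_Poly /=; apply/eqP; rewrite -[RHS]xE; ring.
- by rewrite monicE lead_coefE ps.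
- by apply/polyOverP => i; rewrite ps; case: i => [|[|[|i]]] /=;
    rewrite ?nth_nil ?rpred0 ?rpred1 ?rpred_int ?intr_int.
Qed.

Lemma in_Qadjoin_eta (theta : algC) (h f g : quadratic int) (n a b : int) (z : algC) :
  quadratic_at g theta != 0 -> n != 0 ->
  n%:~R * z = a%:~R * eta h f g theta + b%:~R -> in_Qadjoin theta z.
Proof.
move=> g0 n0 zE.
pose qpoly (q : quadratic int) : {poly rat} :=
  Poly [:: (qd0 q)%:~R; (qd1 q)%:~R; (qd2 q)%:~R].
have qpolyE q : (map_poly ratr (qpoly q)).[theta] = quadratic_at q theta.
  rewrite map_Poly_id0 ?rmorph0 // horner_Poly /= !ratr_int /quadratic_at; ring.
have n0' : n%:~R != 0 :> algC by rewrite intr_eq0.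
exists ((a * qd2 h)%:~R *: qpoly f + b%:~R *: qpoly g), (n%:~R *: qpoly g).
rewrite raddfD /= !map_polyZ !hornerE !qpolyE /= !ratr_int; split.
  by rewrite mulf_neq0.
apply: (mulfI n0'); rewrite zE /eta; field.
by rewrite g0 n0'.
Qed.

(** Maximality puts [z] in Q_F. After multiplication of the relation by the resultant, [eta_coords]
    expresses its right side in the basis, and [zeta_free] compares coordinates. The lemma serves
    for [z] equal to 0, to [eta] and to a quadratic integer built from [disc h]. *)
Lemma minors_of_Aint (F : quartic int) (theta : algC) (h f g : quadratic int)
    (n a b : int) (z : algC) :
  irreducible_quartic F -> is_root_of F theta -> QF_maximal F theta ->
  quartic_form F = form_comp h f g -> resultant2 f g != 0 ->
  n != 0 -> z \in Aint -> n%:~R * z = a%:~R * eta h f g theta + b%:~R ->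
  exists k1 k2 k3 : int,
    [/\ a * minor1 f g = n * resultant2 f g * k1,
        a * minor2 f g = n * resultant2 f g * k2
      & a * minor3 f g = n * resultant2 f g * k3].
Proof.
move=> irrF Ftheta Fmax FE R0 n0 zint zE.
have g0 := quadratic_at_neq0 irrF Ftheta R0.
have /in_QF_coords[k0 [k1 [k2 [k3 kE]]]] : in_QF F theta z.
  by apply/Fmax; split=> //; apply: in_Qadjoin_eta zE.
have [m mE] := eta_coords FE Ftheta g0.
have [|E1 E2 E3] := zeta_free (k0 := n * resultant2 f g * k0 + a * m - b * resultant2 f g)
  (k1 := n * resultant2 f g * k1 + a * minor1 f g)
  (k2 := n * resultant2 f g * k2 + a * minor2 f g)
  (k3 := n * resultant2 f g * k3 + a * minor3 f g) irrF Ftheta.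
  have := congr1 (fun x => (resultant2 f g)%:~R * x) zE.
  rewrite mulrDr (mulrCA _ a%:~R) mE kE => E.
  by move/eqP: E; rewrite -subr_eq0 => /eqP E; rewrite -[RHS]E; ring.
exists (- k1), (- k2), (- k3); split; lra.
Qed.

(** With [r] the resultant, substitution into its expression in the minors gives
    [r = d^2 r^2 (k2^2 - k3 k1)]; cancelling one [r] shows that [d] and [r] are units. *)
Lemma minors_multiple (f g : quadratic int) (d k1 k2 k3 : int) :
  resultant2 f g != 0 ->
  minor1 f g = d * resultant2 f g * k1 -> minor2 f g = d * resultant2 f g * k2 ->
  minor3 f g = d * resultant2 f g * k3 ->
  `|d| = 1 /\ `|resultant2 f g| = 1.
Proof.
move=> R0 E1 E2 E3; set r := resultant2 f g in R0 E1 E2 E3 *.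
have E : d * (d * (r * (k2 ^+ 2 - k3 * k1))) = 1.
  apply: (mulfI R0); rewrite mulr1 -[RHS]/(minor2 f g ^+ 2 - minor3 f g * minor1 f g).
  by rewrite E1 E2 E3; ring.
split; first exact: norm_int_mul_eq1 E.
by apply: (@norm_int_mul_eq1 _ (d * d * (k2 ^+ 2 - k3 * k1))); rewrite -E; ring.
Qed.

(** As [2 * eta + h1] is a square root of [disc h], this excludes the discriminants 0 and 1. *)
Lemma two_eta_not_int (F : quartic int) (theta : algC) (h f g : quadratic int)
    (m : int) :
  irreducible_quartic F -> is_root_of F theta -> QF_maximal F theta ->
  quartic_form F = form_comp h f g -> resultant2 f g != 0 ->
  2 * eta h f g theta <> m%:~R.
Proof.
move=> irrF Ftheta Fmax FE R0 etaE.
(* With z = 0 the integer n is free, and n = 4 makes 2 a unit. *)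
have [|k1 [k2 [k3 [E1 E2 E3]]]] := minors_of_Aint (n := 2 * 2) (a := 2)
  (b := - m) (z := 0) irrF Ftheta Fmax FE R0 isT (rpred0 _).
  by rewrite mulr0 etaE; ring.
by have [] := minors_multiple R0 (cancel2 E1) (cancel2 E2) (cancel2 E3).
Qed.

Lemma resultant_unit (F : quartic int) (theta : algC) (h f g : quadratic int) :
  irreducible_quartic F -> is_root_of F theta -> QF_maximal F theta ->
  quartic_form F = form_comp h f g -> resultant2 f g != 0 ->
  `|resultant2 f g| = 1.
Proof.
move=> irrF Ftheta Fmax FE R0; have g0 := quadratic_at_neq0 irrF Ftheta R0.
have etaint : eta h f g theta \in Aint by apply: Aint_quadratic (eta_root FE Ftheta g0).
have [|k1 [k2 [k3 [E1 E2 E3]]]] := minors_of_Aint (n := 1) (a := 1) (b := 0)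
  irrF Ftheta Fmax FE R0 isT etaint; first by ring.
rewrite !mul1r in E1 E2 E3.
by have [|||] := @minors_multiple f g 1 k1 k2 k3 R0; rewrite ?mul1r.
Qed.

Lemma disc_fundamental (F : quartic int) (theta : algC) (h f g : quadratic int) :
  irreducible_quartic F -> is_root_of F theta -> QF_maximal F theta ->
  quartic_form F = form_comp h f g -> resultant2 f g != 0 ->
  fundamental_discriminant (disc h).
Proof.
move=> irrF Ftheta Fmax FE R0; have g0 := quadratic_at_neq0 irrF Ftheta R0.
pose s := 2 * eta h f g theta + (qd1 h)%:~R.
have s2 : s ^+ 2 = (disc h)%:~R.
  by rewrite -[RHS]addr0 -[X in _ + X](mulr0 4) -(eta_root FE Ftheta g0) /s /disc; ring.
have s_int m : s <> m%:~R.
  move=> sm; apply: (two_eta_not_int (m := m - qd1 h) irrF Ftheta Fmax FE R0).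
  by rewrite rmorphB /= -sm /s addrK.
have Dm4 : ((disc h) %% 4)%Z = 0 \/ ((disc h) %% 4)%Z = 1.
  by rewrite /disc -mulrA; apply: modz4_sqr_sub.
apply: fundamental_discriminant_minimal => // [D1 | d b c DE].
  have : (s - 1) * (s + 1) = 0 by rewrite -subr_sqr s2 D1 expr1n subrr.
  move/eqP; rewrite mulf_eq0 subr_eq0 addr_eq0 => /orP[]/eqP sE.
    by apply: (s_int 1).
  by apply: (s_int (-1)); rewrite sE rmorphN.
have d0 : d != 0.
  apply/eqP => d0; apply: (s_int 0); apply/eqP.
  by rewrite -(sqrf_eq0 s) s2 DE d0 expr0n mul0r.
have d0' : d%:~R != 0 :> algC by rewrite intr_eq0.
(* Since [s / d] is a square root of [b ^+ 2 - 4 * c], [w] is a root of the monic integral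
   polynomial [X^2 - b X + c]. *)
pose w : algC := (s / d%:~R + b%:~R) / 2.
have wE : w ^+ 2 + (- b)%:~R * w + c%:~R = 0.
  have -> : w ^+ 2 + (- b)%:~R * w + c%:~R =
      (s ^+ 2 / d%:~R ^+ 2 - (b ^+ 2 - 4 * c)%:~R) / 4 by rewrite /w; field.
  by rewrite s2 DE; field.
(* Clearing denominators gives [2 d w = 2 eta + h1 + b d]; the common factor 2 is cancelled
   afterwards. *)
have [||k1 [k2 [k3 [E1 E2 E3]]]] := minors_of_Aint (n := 2 * d) (a := 2)
  (b := qd1 h + b * d) (z := w) irrF Ftheta Fmax FE R0 _ (Aint_quadratic wE).
- by rewrite mulf_neq0.
- by rewrite /w /s; field.
by have [] := minors_multiple R0 (cancel2 E1) (cancel2 E2) (cancel2 E3).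
Qed.

(** * Nonzero minors, primitivity and the discriminant of J *)

(** Serves to exclude a zero proportionality factor. If both minors vanished, then [g2 f = f2 g], so
    [f2^2 h(f, g) = a4 f^2], and likewise for [g]. At [theta] this forces [f2 = g2 = 0], hence
    [a4 = 0]. *)
Lemma minors_neq0 (F : quartic int) (theta : algC) (h f g : quadratic int) :
  irreducible_quartic F -> is_root_of F theta ->
  quartic_form F = form_comp h f g -> minor3 f g = 0 -> minor2 f g <> 0.
Proof.
move=> irrF Ftheta FE M3 M2; have a4 := irreducible_quartic_lead irrF.
have Fhfg := form_comp_at_root FE Ftheta.
have [a4E _ _ _ _] := quartic_form_comp_coefs FE.
have fg : (qd2 g)%:~R * quadratic_at f theta - (qd2 f)%:~R * quadratic_at g theta = 0.
  have -> : 0 = (minor2 f g)%:~R - (minor3 f g)%:~R * theta by rewrite M3 M2; ring.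
  by rewrite /quadratic_at /minor3 /minor2; ring.
have lead0 (q : quadratic int) :
    (qt4 F)%:~R * quadratic_at q theta ^+ 2 = 0 -> qd2 q = 0.
  move/eqP; rewrite mulf_eq0 intr_eq0 (negPf a4) sqrf_eq0 => /eqP q0.
  have [|_ _ //] := theta_powers_free (c0 := qd0 q) (c1 := qd1 q)
    (c2 := qd2 q) (c3 := 0) irrF Ftheta.
  by rewrite -[RHS]q0 /quadratic_at; ring.
have f0 : qd2 f = 0.
  (* The multiplier is the cofactor of [g2 f - f2 g] in [a4 f^2 - f2^2 h(f, g)]. *)
  apply: lead0; have := congr1 (fun x => x * ((qd1 h * qd2 f)%:~R * quadratic_at f theta
    + (qd0 h)%:~R * ((qd2 g)%:~R * quadratic_at f theta
                     + (qd2 f)%:~R * quadratic_at g theta))) fg.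
  have := congr1 (fun x => (qd2 f)%:~R ^+ 2 * x) Fhfg.
  rewrite /= mul0r mulr0 => E1 E2.
  by rewrite -[RHS]addr0 -[X in X + _]E1 -[X in _ + X]E2 a4E; ring.
have g0 : qd2 g = 0.
  apply: lead0; have := congr1 (fun x => x * ((qd1 h * qd2 g)%:~R * quadratic_at g theta
    + (qd2 h)%:~R * ((qd2 g)%:~R * quadratic_at f theta
                     + (qd2 f)%:~R * quadratic_at g theta))) fg.
  have := congr1 (fun x => (qd2 g)%:~R ^+ 2 * x) Fhfg.
  rewrite /= mul0r mulr0 => E1 E2.
  by rewrite -[RHS]subr0 -[X in X - _]E1 -[X in _ - X]E2 a4E; ring.
by move/eqP: a4; apply; rewrite a4E f0 g0; ring.
Qed.

(** A common divisor of the minors divides the resultant, a quadratic form in them. *)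
Lemma primitive_pair_resultant (f g : quadratic int) :
  `|resultant2 f g| = 1 -> primitive_pair f g.
Proof.
move=> R1; split.
  rewrite disc_jacobian mulf_neq0 // -normr_eq0 R1 //.
rewrite /= [(2 * _)%R]mulrC mulzK //.
set d := gcdz _ _.
have /and3P[d3 d2 d1] : [&& (d %| minor3 f g)%Z, (d %| minor2 f g)%Z & (d %| minor1 f g)%Z].
  have := dvdzz d; rewrite {2}/d !dvdz_gcd => /andP[/andP[d3 d2] d1].
  by rewrite /minor2 -opprB rpredN; apply/and3P.
have dR : (d %| resultant2 f g)%Z.
  by rewrite /resultant2 rpredB ?dvdz_mulr // expr2 dvdz_mulr.
have [E|E] := normr1_cases R1.
all: by move: dR; rewrite E ?rpredN dvdz1 => /eqP dE; rewrite -[LHS]gez0_abs ?dE.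
Qed.

(** Primitivity of [J] makes the rational factor an integer [n], and [n ^+ 2] divides 4. *)
Lemma disc_of_proportional (J K : quadratic int) :
  primitive_quadratic J -> proportional K J ->
  disc K = 4 \/ disc K = - 4 ->
  [\/ disc J = 1, disc J = 4 | disc J = - 4].
Proof.
move=> Jprim /proportional_coefs[c [E2 E1 E0]] DK.
have [n nE] : exists n : int, c = n%:~R.
  have [u [v uv]] := Bezoutz (gcdz (qd2 J) (qd1 J)) (qd0 J).
  have [u' [v' uv']] := Bezoutz (qd2 J) (qd1 J).
  (* The Bezout combination that gives 1 on the coefficients of [J] gives [c] on those of [K]. *)
  exists (u * (u' * qd2 K + v' * qd1 K) + v * qd0 K).
  have Jprim' := congr1 (intr : int -> rat) Jprim.
  rewrite -uv -uv' !rmorphD !rmorphM /= in Jprim'.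
  rewrite !rmorphD !rmorphM !rmorphD !rmorphM /= E2 E1 E0.
  by rewrite -[LHS]mulr1 -[X in _ * X]Jprim'; ring.
have {E2} E2 : qd2 K = n * qd2 J by apply: (@intr_inj rat); rewrite E2 nE rmorphM.
have {E1} E1 : qd1 K = n * qd1 J by apply: (@intr_inj rat); rewrite E1 nE rmorphM.
have {E0} E0 : qd0 K = n * qd0 J by apply: (@intr_inj rat); rewrite E0 nE rmorphM.
have DKJ : disc K = n ^+ 2 * disc J by rewrite /disc E2 E1 E0; ring.
(* This rules out [disc J = -1] when [n] is 2 or -2. *)
have Dm4 : ((disc J) %% 4)%Z = 0 \/ ((disc J) %% 4)%Z = 1.
  by rewrite /disc -mulrA; apply: modz4_sqr_sub.
have n4 : (n ^+ 2 %| 4)%Z.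
  by have := dvdz_mulr (disc J) (dvdzz (n ^+ 2)); rewrite -DKJ; case: DK => ->;
    rewrite ?rpredN.
have {n4} n2 : (`|n| <= 2)%N.
  have := dvdn_leq (isT : 0 < 4)%N n4; rewrite abszX; move: `|n|%N => m.
  by rewrite (leq_exp2r m 2).
move: DK; rewrite DKJ; move: (disc J) Dm4 n2; clear => D.
have nE : (`|n| <= 2)%N -> [|| n == 0, n == 1, n == -1, n == 2 | n == -2] by lia.
move=> Dm4 /nE/or4P[| | |/orP[]] /eqP-> DE; move: DE; rewrite ?expr0n ?sqrrN ?mul0r.
- by case.
- by rewrite expr1n mul1r => -[] ->; [constructor 2 | constructor 3].
- by rewrite expr1n mul1r => -[] ->; [constructor 2 | constructor 3].
- by move=> DE; constructor 1; lia.
- by move=> DE; constructor 1; lia.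
Qed.

Theorem theorem3p2 (J : quadratic int) (F : quartic int) (theta : algC)
    (h f g : quadratic int) :
  primitive_quadratic J ->
  disc J <> 0 ->
  in_VJ J F ->
  irreducible_quartic F ->
  is_root_of F theta ->
  QF_maximal F theta ->
  quartic_form F = form_comp h f g ->
  proportional (jacobian f g) J ->
  [/\ fundamental_discriminant (disc h),
      primitive_pair f g,
      disc (jacobian f g) = 4 \/ disc (jacobian f g) = - 4
    & [\/ disc J = 1, disc J = 4 | disc J = - 4]].
Proof.
move=> Jprim DJ _ irrF Ftheta Fmax FE prop.
(* The discriminants differ by the factor [c ^+ 2], so a zero resultant would give [c = 0], and then
   [minor2] and [minor3] would both vanish. *)
have R0 : resultant2 f g != 0.
  have [c [E2 E1 E0]] := proportional_coefs prop.
  have DKJ : (disc (jacobian f g))%:~R = c ^+ 2 * (disc J)%:~R :> rat.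
    transitivity ((qd1 (jacobian f g))%:~R ^+ 2
      - 4 * (qd2 (jacobian f g))%:~R * (qd0 (jacobian f g))%:~R : rat).
      by rewrite /disc; ring.
    by rewrite E2 E1 E0 /disc; ring.
  apply/eqP => R0; move: DKJ; rewrite disc_jacobian R0 mulr0 => /esym/eqP.
  rewrite mulf_eq0 sqrf_eq0 intr_eq0 => /orP[/eqP c0|/eqP //].
  apply: (minors_neq0 irrF Ftheta FE).
    by apply/eqP; rewrite -(intr_eq0 rat) -[minor3 f g]/(qd2 (jacobian f g)) E2 c0 mul0r.
  apply/eqP; move/eqP: E1; rewrite c0 mul0r intr_eq0 /= mulf_eq0 /=.
  by rewrite /minor2 -oppr_eq0 opprB.
have R1 := resultant_unit irrF Ftheta Fmax FE R0.
have DK : disc (jacobian f g) = 4 \/ disc (jacobian f g) = - 4.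
  rewrite disc_jacobian; case/normr1_cases: R1 => ->; [left | right]; ring.
split=> //.
- exact: disc_fundamental irrF Ftheta Fmax FE R0.
- exact: primitive_pair_resultant.
- exact: disc_of_proportional Jprim prop DK.
Qed.
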